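(* Let $(\mathcal{X},d_{\mathcal{X}})$ be a metric space and $H\subseteq\mathbb{K}^{\mathcal{X}}$ a Hilbert space of functions. Suppose there exists $\alpha\in\mathbb{R}_{>0}$ such that every $f\in H$ is $\alpha$-H\''older continuous with H\''older constant $\|f\|_H$. Suppose furthermore that $H$ is an RKHS, and let $k$ be the uniquely determined kernel with $H_k=H$. Then: 1. For all $x\in\mathcal{X}$, $k(\cdot,x)\in H$ is $\alpha$-H\''older continuous with H\''older constant $\sqrt{k(x,x)}$. If $k$ is bounded, then $k(\cdot,x)$ is $\alpha$-H\''older continuous with H\''older constant $\|k\|_\infty$, for all $x\in\mathcal{X}$. 2. For all $x_1,x_1',x_2,x_2'\in\mathcal{X}$, $$|k(x_1,x_2)-k(x_1',x_2')| \leq \min\left\{\max\{\sqrt{k(x_2,x_2)},\sqrt{k(x_1',x_1')}\},\ \max\{\sqrt{k(x_1,x_1)},\sqrt{k(x_2',x_2')}\}\right\}\left(d_{\mathcal{X}}(x_1,x_1')^\alpha+d_{\mathcal{X}}(x_2,x_2')^\alpha\right).$$ If $k$ is bounded, then $|k(x_1,x_2)-k(x_1',x_2')|\leq \|k\|_\infty\left(d_{\mathcal{X}}(x_1,x_1')^\alpha+d_{\mathcal{X}}(x_2,x_2')^\alpha\right)$ for all $x_1,x_1',x_2,x_2'\in\mathcal{X}$. 3. For all $x,x'\in\mathcal{X}$, $$d_k(x,x')\leq\sqrt{\sqrt{k(x,x)}+\sqrt{k(x',x')}}\; d_{\mathcal{X}}(x,x')^{\frac{\alpha}{2}}.$$ If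 $k$ is bounded, then $d_k(x,x')\leq\sqrt{2\|k\|_\infty}\,d_{\mathcal{X}}(x,x')^{\frac{\alpha}{2}}$ for all $x,x'\in\mathcal{X}$. 4. If $(\mathcal{H},\Phi)$ is any feature space-feature map pair for $k$, and $k$ is bounded, then $\Phi$ is $\frac{\alpha}{2}$-H\''older continuous with H\''older constant $\sqrt{2\|k\|_\infty}$.
   Context: $\mathbb{K}$ denotes $\mathbb{R}$ or $\mathbb{C}$, and $\mathcal{X}$ is non-empty. A map $g$ between metric spaces is $\alpha$-H\''older continuous with H\''older constant $L\geq 0$ if $d(g(x),g(x'))\leq L\,d(x,x')^\alpha$ for all $x,x'$ (the metric on $\mathbb{K}$ and on Hilbert spaces is the norm metric). A Hilbert space $H$ of functions on $\mathcal{X}$ is an RKHS if all evaluation functionals $f\mapsto f(x)$ are continuous on $H$; it then has a unique reproducing kernel $k$, i.e. $k(\cdot,x)\in H$ and $f(x)=\langle f,k(\cdot,x)\rangle_H$ for all $f\in H$, $x\in\mathcal{X}$, and one writes $H=H_k$. A feature space-feature map pair for $k$ is a $\mathbb{K}$-Hilbert space $\mathcal{H}$ and a map $\Phi:\mathcal{X}\to\mathcal{H}$ with $k(x,x')=\langle\Phi(x'),\Phi(x)\rangle_{\mathcal{H}}$ for all $x,x'$. The kernel (semi)metric is $d_k(x,x')=\|k(\cdot,x)-k(\cdot,x')\|_{H_k}$. $\|k\|_\infty:=\sup_{x\in\mathcal{X}}\sqrt{k(x,x)}$, which is finite if and only if $k$ is bounded. *)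

(* Defs.v *)
From HB Require Import structures.
From mathcomp Require Import all_boot all_order all_algebra.
From mathcomp Require Import sesquilinear complex.
From mathcomp Require Import all_classical all_reals all_analysis.

Set Implicit Arguments.
Unset Strict Implicit.
Unset Printing Implicit Defensive.

Import Order.TTheory GRing.Theory Num.Theory.
Import numFieldNormedType.Exports.

Local Open Scope classical_set_scope.
Local Open Scope ring_scope.

Variant scalar_kind := RealScalars | ComplexScalars.

Definition scalarField (R : realType) (s : scalar_kind) : numFieldType :=
  match s with
  | RealScalars => R
  | ComplexScalars => R[i]
  end.

Definition conjS (R : realType) (s : scalar_kind) :
    {rmorphism scalarField R s -> scalarField R s} :=
  match s with
  | RealScalars => idfun
  | ComplexScalars => Num.conj
  end.

Definition reS (R : realType) (s : scalar_kind) : scalarField R s -> R :=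
  match s return scalarField R s -> R with
  | RealScalars => fun x : R => x
  | ComplexScalars => fun z : R[i] => complex.Re z
  end.

(* Over complex scalars the library norm takes values in [R[i]] (as nonnegative
   reals); [normR] is the same norm with values in [R]. *)
Definition normR (R : realType) (s : scalar_kind)
    (V : normedZmodType (scalarField R s)) (v : V) : R :=
  reS `|v|.

(* The inner product is linear in its first argument and conjugate-linear in
   the second one. *)
Record hilbertSpace (R : realType) (s : scalar_kind) := HilbertSpace {
  hilbert_sort :> completeNormedModType (scalarField R s);
  inner : {dot hilbert_sort for conjS R s};
  sqr_norm_inner : forall v : hilbert_sort, `|v| ^+ 2 = inner v v }.

Section Kernels.
Context (R : realType) (s : scalar_kind).

Definition holder_continuous (X : metricType R)
    (V : normedZmodType (scalarField R s)) (alpha L : R) (g : X -> V) : Prop :=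
  0 <= L /\ forall x x' : X, normR (g x - g x') <= L * mdist x x' `^ alpha.

(* A Hilbert space of functions on [X] is a Hilbert space [H] together with an
   injective linear map [ev] sending an element of [H] to the function it is. *)
Record hilbertFunctionSpace (X : Type) := HilbertFunctionSpace {
  hfs_space :> hilbertSpace R s;
  ev : {linear hfs_space -> (X -> scalarField R s)};
  ev_inj : injective ev }.

Definition is_rkhs (X : Type) (H : hilbertFunctionSpace X) : Prop :=
  forall x : X, continuous (fun f : H => ev H f x).

(* [kx x] is the element of [H] whose underlying function is [k(., x)]; it is
   determined by [k] because [ev H] is injective. *)
Definition reproducing_kernel (X : Type) (H : hilbertFunctionSpace X)
    (k : X -> X -> scalarField R s) (kx : X -> H) : Prop :=
  (forall x : X, ev H (kx x) = k ^~ x) /\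
  (forall (f : H) (x : X), ev H f x = inner H f (kx x)).

Definition kernel_metric (X : Type) (H : hilbertFunctionSpace X)
    (kx : X -> H) (x x' : X) : R :=
  normR (kx x - kx x').

Definition feature_pair (X : Type) (k : X -> X -> scalarField R s)
    (F : hilbertSpace R s) (Phi : X -> F) : Prop :=
  forall x x' : X, k x x' = inner F (Phi x') (Phi x).

Definition bounded_kernel (X : Type) (k : X -> X -> scalarField R s) : Prop :=
  bounded_fun (fun p : X * X => k p.1 p.2).

Definition sqrt_diag (X : Type) (k : X -> X -> scalarField R s) (x : X) : R :=
  Num.sqrt (reS (k x x)).

(* Meaningful for nonempty [X] and bounded [k]; [sup] is [0] by convention
   when the range is empty or unbounded. *)
Definition kernel_sup_norm (X : Type) (k : X -> X -> scalarField R s) : R :=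
  sup (range (sqrt_diag k)).

End Kernels.

(* Main.v *)
Require Import Defs.
From HB Require Import structures.
From mathcomp Require Import all_boot all_order all_algebra.
From mathcomp Require Import sesquilinear complex.
From mathcomp Require Import all_classical all_reals all_analysis.

Set Implicit Arguments.
Unset Strict Implicit.
Unset Printing Implicit Defensive.

Import Order.TTheory GRing.Theory Num.Theory.
Import numFieldNormedType.Exports.

Local Open Scope classical_set_scope.
Local Open Scope ring_scope.

(** The reproducing property gives [k x x' = <kx x', kx x>], so [sqrt_diag k x]
is the norm of [kx x] and the Hölder hypothesis applied to [kx x] says that
[k ^~ x] has Hölder constant [sqrt_diag k x]: this is the first item.  By
Hermitian symmetry, [k x] has the same Hölder constant.  For the second item,
[k x1 x2 - k x1' x2'] is split along either [k x1' x2] or [k x1 x2']; each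
splitting produces one of the two maxima.

For the third and fourth items, any feature map satisfies
[|Phi x - Phi x'|^2 = (k x x - k x' x) - (k x x' - k x' x')], and the first
item bounds both differences.  The third item is the case of the canonical
feature map [kx].  The bounded versions replace [sqrt_diag k x] by its
supremum. *)

(** * Real-valued norms over real or complex scalars *)

Section ScalarField.
Context (R : realType) (s : scalar_kind).
Implicit Types a b : scalarField R s.

Lemma le_reS a b : a <= b -> reS a <= reS b.
Proof. by case: s a b => //= a b; rewrite lecE => /andP[]. Qed.

Lemma reSD a b : reS (a + b) = reS a + reS b.
Proof. by case: s a b => //= -[? ?] [? ?]. Qed.

Lemma reS0 : reS (0 : scalarField R s) = 0.
Proof. by case: s. Qed.

(** Over the complex numbers, [0 <= a] says that [a] is real and nonnegative;
without realness, the square of the imaginary part would contribute. *)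
Lemma reS_sqr a : 0 <= a -> reS (a ^+ 2) = reS a ^+ 2.
Proof.
case: s a => //= -[a a']; rewrite lecE /= => /andP[/eqP -> _].
by rewrite !expr2 /= mulr0 subr0.
Qed.

Lemma reS_le_norm a : reS a <= normR a.
Proof.
rewrite /normR; case: s a => /= a; first exact: ler_norm.
have := normc_ge_Re a; rewrite lecE => /andP[_]; apply: le_trans.
exact: ler_norm.
Qed.

Lemma normR_conjS a : normR (conjS R s a) = normR a.
Proof. by rewrite /normR; case: s a => // a; congr reS; exact: norm_conjC. Qed.

Section NormedZmodule.
Context (V : normedZmodType (scalarField R s)).
Implicit Types u v : V.

Lemma normR_ge0 v : 0 <= normR v.
Proof. by rewrite /normR -reS0 le_reS. Qed.

Lemma ler_normRD u v : normR (u + v) <= normR u + normR v.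
Proof. by rewrite /normR -reSD le_reS// ler_normD. Qed.

Lemma ler_normR_distD w u v : normR (u - v) <= normR (u - w) + normR (w - v).
Proof. by rewrite -(subrKA w) ler_normRD. Qed.

End NormedZmodule.

Lemma sqr_normR (H : hilbertSpace R s) (v : H) :
  normR v ^+ 2 = reS (inner H v v).
Proof. by rewrite -sqr_norm_inner reS_sqr. Qed.

Lemma conjS_inner (H : hilbertSpace R s) (u v : H) :
  inner H u v = conjS R s (inner H v u).
Proof. by rewrite hermC expr0 mul1r. Qed.

End ScalarField.

(** * Feature maps and the diagonal of the kernel *)

Section FeatureMaps.
Context (R : realType) (s : scalar_kind) (X : Type).
Implicit Types k : X -> X -> scalarField R s.

Lemma sqrt_diag_ge0 k x : 0 <= sqrt_diag k x.
Proof. exact: sqrtr_ge0. Qed.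

Lemma reproducing_kernel_feature_pair (H : hilbertFunctionSpace R s X) k
    (kx : X -> H) : reproducing_kernel k kx -> feature_pair k kx.
Proof. by move=> [evk repr] x x'; rewrite -repr evk. Qed.

(** [feature_pair k Phi] alone gives [k] the usual properties of a kernel: its
diagonal consists of squared norms and it is Hermitian. *)
Section Pair.
Context k (F : hilbertSpace R s) (Phi : X -> F) (kPhi : feature_pair k Phi).

Lemma sqrt_diagE x : sqrt_diag k x = normR (Phi x).
Proof. by rewrite /sqrt_diag kPhi -sqr_normR sqrtr_sqr ger0_norm// normR_ge0. Qed.

Lemma feature_pair_conjS x x' : k x x' = conjS R s (k x' x).
Proof. by rewrite !kPhi conjS_inner. Qed.

(** The four terms of the expanded square are grouped so that each difference
varies the first argument of [k] only. *)
Lemma sqr_normR_featureB x x' :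
  normR (Phi x - Phi x') ^+ 2 =
  reS ((k x x - k x' x) + (k x' x' - k x x')).
Proof.
rewrite sqr_normR !kPhi linearBl !linearBr; congr reS.
by rewrite /= opprB.
Qed.

End Pair.

(** Boundedness is needed for [sup] to be an upper bound; the bound [M + 1] lives
in the scalar field, and its real part bounds the diagonal. *)
Lemma sqrt_diag_le_sup_norm k x :
  bounded_kernel k -> sqrt_diag k x <= kernel_sup_norm k.
Proof.
move=> [M [_ bM]]; apply: ub_le_sup; last by exists x.
have {}bM : forall p, `|k p.1 p.2| <= M + 1.
  by move=> p; apply: bM => //; rewrite ltrDl.
exists (Num.sqrt (reS (M + 1))) => _ [y _ <-]; apply: ler_wsqrtr.
by apply: le_trans (reS_le_norm _) (le_reS _); exact: (bM (y, y)).
Qed.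

End FeatureMaps.

(** * Hölder estimates *)

Section Holder.
Context (R : realType) (s : scalar_kind) (X : metricType R) (alpha : R).
Implicit Types (L : R) (k : X -> X -> scalarField R s).

Lemma holder_continuous_le (V : normedZmodType (scalarField R s)) L L'
    (g : X -> V) :
  L <= L' -> holder_continuous alpha L g -> holder_continuous alpha L' g.
Proof.
move=> LL' [L0 gL]; split=> [|x x']; first exact: le_trans LL'.
by apply: le_trans (gL x x') _; rewrite ler_wpM2r// powR_ge0.
Qed.

Lemma ler_maxMD (a b u v : R) : 0 <= u -> 0 <= v ->
  a * u + b * v <= Num.max a b * (u + v).
Proof. by move=> u0 v0; rewrite mulrDr lerD// ler_wpM2r// le_max lexx ?orbT. Qed.

Section Kernel.
Context k (kH : forall x, holder_continuous alpha (sqrt_diag k x) (k ^~ x))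
  (kC : forall x x', k x x' = conjS R s (k x' x)).

Lemma kernel_holderl y x x' :
  normR (k x y - k x' y) <= sqrt_diag k y * mdist x x' `^ alpha.
Proof. by case: (kH y) => _; apply. Qed.

Lemma kernel_holderr y x x' :
  normR (k y x - k y x') <= sqrt_diag k y * mdist x x' `^ alpha.
Proof. by rewrite (kC y x) (kC y x') -rmorphB normR_conjS kernel_holderl. Qed.

Lemma kernel_holder2 x1 x1' x2 x2' :
  normR (k x1 x2 - k x1' x2') <=
  Num.min (Num.max (sqrt_diag k x2) (sqrt_diag k x1'))
          (Num.max (sqrt_diag k x1) (sqrt_diag k x2')) *
  (mdist x1 x1' `^ alpha + mdist x2 x2' `^ alpha).
Proof.
(* Both maxima are bounds, so it does not matter which one is the minimum. *)
rewrite minEle; case: ifP => _.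
- apply: le_trans (ler_normR_distD (k x1' x2) _ _) _.
  apply: le_trans (ler_maxMD _ _ (powR_ge0 _ _) (powR_ge0 _ _)).
  by rewrite lerD// ?kernel_holderl ?kernel_holderr.
- apply: le_trans (ler_normR_distD (k x1 x2') _ _) _.
  rewrite [X in _ * X]addrC.
  apply: le_trans (ler_maxMD _ _ (powR_ge0 _ _) (powR_ge0 _ _)).
  by rewrite lerD// ?kernel_holderl ?kernel_holderr.
Qed.

Lemma feature_map_holder (F : hilbertSpace R s) (Phi : X -> F) x x' :
  feature_pair k Phi ->
  normR (Phi x - Phi x') <=
  Num.sqrt (sqrt_diag k x + sqrt_diag k x') * mdist x x' `^ (alpha / 2).
Proof.
move=> kPhi; rewrite powRrM powR12_sqrt ?powR_ge0//.
rewrite -sqrtrM ?addr_ge0 ?sqrt_diag_ge0//.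
rewrite -[leLHS]ger0_norm ?normR_ge0// -sqrtr_sqr ler_wsqrtr//.
rewrite (sqr_normR_featureB kPhi); apply: le_trans (reS_le_norm _) _.
rewrite mulrDl; apply: le_trans (ler_normRD _ _) _.
by rewrite lerD ?kernel_holderl// (metric_sym x) kernel_holderl.
Qed.

Lemma bounded_feature_map_holder (F : hilbertSpace R s) (Phi : X -> F) :
  feature_pair k Phi -> bounded_kernel k ->
  holder_continuous (alpha / 2) (Num.sqrt (2 * kernel_sup_norm k)) Phi.
Proof.
move=> kPhi bk; split=> [|x x']; first exact: sqrtr_ge0.
apply: le_trans (feature_map_holder _ _ kPhi) _.
rewrite ler_wpM2r ?powR_ge0// ler_wsqrtr// mulr2n mulrDl mul1r.
by rewrite lerD ?sqrt_diag_le_sup_norm.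
Qed.

End Kernel.
End Holder.

Theorem proposition4p10 (R : realType) (s : scalar_kind) (X : metricType R)
    (hX : [set: X] !=set0) (H : hilbertFunctionSpace R s X)
    (alpha : R) (halpha : 0 < alpha)
    (hholder : forall f : H, holder_continuous alpha (normR f) (ev H f))
    (hrkhs : is_rkhs H)
    (k : X -> X -> scalarField R s) (kx : X -> H)
    (hk : reproducing_kernel k kx) :
  ((forall x : X, holder_continuous alpha (sqrt_diag k x) (k ^~ x)) /\
   (bounded_kernel k ->
      forall x : X, holder_continuous alpha (kernel_sup_norm k) (k ^~ x))) /\
  ((forall x1 x1' x2 x2' : X,
      normR (k x1 x2 - k x1' x2') <=
      Num.min (Num.max (sqrt_diag k x2) (sqrt_diag k x1'))
              (Num.max (sqrt_diag k x1) (sqrt_diag k x2')) *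
      (mdist x1 x1' `^ alpha + mdist x2 x2' `^ alpha)) /\
   (bounded_kernel k ->
      forall x1 x1' x2 x2' : X,
      normR (k x1 x2 - k x1' x2') <=
      kernel_sup_norm k * (mdist x1 x1' `^ alpha + mdist x2 x2' `^ alpha))) /\
  ((forall x x' : X,
      kernel_metric kx x x' <=
      Num.sqrt (sqrt_diag k x + sqrt_diag k x') * mdist x x' `^ (alpha / 2)) /\
   (bounded_kernel k ->
      forall x x' : X,
      kernel_metric kx x x' <=
      Num.sqrt (2 * kernel_sup_norm k) * mdist x x' `^ (alpha / 2))) /\
  (forall (F : hilbertSpace R s) (Phi : X -> F),
     feature_pair k Phi -> bounded_kernel k ->
     holder_continuous (alpha / 2) (Num.sqrt (2 * kernel_sup_norm k)) Phi).

Proof.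
have kf := reproducing_kernel_feature_pair hk.
have kC := feature_pair_conjS kf.
have kH x : holder_continuous alpha (sqrt_diag k x) (k ^~ x).
  by rewrite (sqrt_diagE kf) -(proj1 hk); exact: hholder.
split; [split|split; [split|split; [split|]]].
- exact: kH.
- by move=> bk x; apply: holder_continuous_le (kH x); exact: sqrt_diag_le_sup_norm.
- exact: kernel_holder2.
- move=> bk x1 x1' x2 x2'; apply: le_trans (kernel_holder2 kH kC _ _ _ _) _.
  rewrite ler_wpM2r ?addr_ge0 ?powR_ge0//.
  by rewrite ge_min ge_max !sqrt_diag_le_sup_norm.
- by move=> x x'; exact: feature_map_holder.
- by move=> bk; case: (bounded_feature_map_holder kH kf bk).
- by move=> F Phi kPhi; exact: bounded_feature_map_holder.
Qed.
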